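(* Let $\Gamma$ be a finite simple graph such that $S\Omega(\Gamma)$ is isomorphic to one of the graphs $4K_1$ (four isolated vertices), $K_1+P_3$ (disjoint union of an isolated vertex and a path on three vertices), $P_4$, $C_4$, or $K_{1,3}$. Then $\mathrm{rank}(I+A(\Gamma))=4$.
   Context: $A(\Gamma)$ is the adjacency matrix of $\Gamma$; rank is over the reals. For a graph $\Gamma$, consider partitions of $V(\Gamma)$ into nonempty parts such that each part induces a complete subgraph and, for any two distinct parts $P,Q$, either every vertex of $P$ is adjacent to every vertex of $Q$ or no vertex of $P$ is adjacent to any vertex of $Q$. The complete skeleton $\Omega(\Gamma)$ is such a partition with the minimum number of parts; its structure $S\Omega(\Gamma)$ is the simple graph whose vertices are the parts, two parts being adjacent iff they are completely joined. *)

(* Defs.v *)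
From HB Require Import structures.
From mathcomp Require Import all_boot all_order all_algebra.
From mathcomp Require Import reals.

Set Implicit Arguments.
Unset Strict Implicit.
Unset Printing Implicit Defensive.

Import GRing.Theory.

Record sgraph := SGraph {
  svertex :> finType;
  sedge : rel svertex;
  sedge_sym : symmetric sedge;
  sedge_irr : irreflexive sedge }.

Definition sg_iso (G H : sgraph) : Prop :=
  exists2 f : G -> H, bijective f & {mono f : x y / sedge x y}.

Section DisjointUnion.
Variables G H : sgraph.

Definition union_rel (u v : G + H) : bool :=
  match u, v with
  | inl x, inl y => sedge x y
  | inr x, inr y => sedge x y
  | _, _ => false
  end.

Fact union_rel_sym : symmetric union_rel.
Proof. by move=> [x|x] [y|y] //=; apply: sedge_sym. Qed.

Fact union_rel_irr : irreflexive union_rel.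
Proof. by move=> [x|x] //=; apply: sedge_irr. Qed.

Definition union_graph : sgraph := SGraph union_rel_sym union_rel_irr.

End DisjointUnion.

Section EdgelessGraph.
Variable n : nat.

Definition edgeless_rel (i j : 'I_n) : bool := false.

Fact edgeless_rel_sym : symmetric edgeless_rel.
Proof. by []. Qed.

Fact edgeless_rel_irr : irreflexive edgeless_rel.
Proof. by []. Qed.

(* n K_1 *)
Definition edgeless_graph : sgraph := SGraph edgeless_rel_sym edgeless_rel_irr.

End EdgelessGraph.

Section PathGraph.
Variable n : nat.

Definition path_rel (i j : 'I_n) : bool := (i.+1 == j) || (j.+1 == i).

Fact path_rel_sym : symmetric path_rel.
Proof. by move=> i j; rewrite /path_rel orbC. Qed.

Fact path_rel_irr : irreflexive path_rel.
Proof. by move=> i; rewrite /path_rel orbb gtn_eqF. Qed.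

(* P_n, where n is the number of vertices *)
Definition path_graph : sgraph := SGraph path_rel_sym path_rel_irr.

End PathGraph.

Section CycleGraph.
Variable n : nat.

(* i != j matters only for the degenerate case n = 1 *)
Definition cycle_rel (i j : 'I_n) : bool :=
  (i != j) && ((i.+1 %% n == j) || (j.+1 %% n == i)).

Fact cycle_rel_sym : symmetric cycle_rel.
Proof. by move=> i j; rewrite /cycle_rel eq_sym orbC. Qed.

Fact cycle_rel_irr : irreflexive cycle_rel.
Proof. by move=> i; rewrite /cycle_rel eqxx. Qed.

Definition cycle_graph : sgraph := SGraph cycle_rel_sym cycle_rel_irr.

End CycleGraph.

Section CompleteBipartiteGraph.
Variables m n : nat.

Definition bipartite_rel (u v : 'I_m + 'I_n) : bool :=
  match u, v with
  | inl _, inr _ | inr _, inl _ => true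
  | _, _ => false
  end.

Fact bipartite_rel_sym : symmetric bipartite_rel.
Proof. by move=> [?|?] [?|?]. Qed.

Fact bipartite_rel_irr : irreflexive bipartite_rel.
Proof. by move=> [?|?]. Qed.

(* K_{m,n} *)
Definition complete_bipartite_graph : sgraph :=
  SGraph bipartite_rel_sym bipartite_rel_irr.

End CompleteBipartiteGraph.

Section CompleteSkeleton.
Variable G : sgraph.

Definition clique (P : {set G}) : Prop :=
  {in P &, forall x y, x != y -> sedge x y}.

Definition joined (P Q : {set G}) : bool :=
  [forall x in P, forall y in Q, sedge x y].

Definition separated (P Q : {set G}) : bool :=
  [forall x in P, forall y in Q, ~~ sedge x y].

(* finset's partition already requires every part to be nonempty *)
Definition complete_partition (Om : {set {set G}}) : Prop :=
  [/\ partition Om [set: G],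
      {in Om, forall P, clique P}
    & {in Om &, forall P Q, P != Q -> joined P Q \/ separated P Q}].

Definition complete_skeleton (Om : {set {set G}}) : Prop :=
  complete_partition Om /\
  forall Om', complete_partition Om' -> #|Om| <= #|Om'|.

Variable Om : {set {set G}}.

Definition structure_rel (P Q : {P : {set G} | P \in Om}) : bool :=
  (P != Q) && joined (val P) (val Q).

Fact structure_rel_sym : symmetric structure_rel.
Proof.
suff jC A B : joined A B -> joined B A.
  by move=> P Q; rewrite /structure_rel eq_sym; congr andb; apply/idP/idP => /jC.
move=> /forall_inP jAB; apply/forall_inP => y By; apply/forall_inP => x Ax.
by rewrite sedge_sym; move/forall_inP: (jAB x Ax); apply.
Qed.

Fact structure_rel_irr : irreflexive structure_rel.
Proof. by move=> P; rewrite /structure_rel eqxx. Qed.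

Definition structure_graph : sgraph :=
  SGraph structure_rel_sym structure_rel_irr.

End CompleteSkeleton.

Local Open Scope ring_scope.

Definition adjacency_mx (R : realType) (G : sgraph) : 'M[R]_#|G| :=
  \matrix_(i, j) (sedge (enum_val i) (enum_val j))%:R.

(* Main.v *)
(** Write [M = I + A(Gamma)] and [N = I + A(S Omega)]. The entry of [M] at [(x, y)]
    depends only on the parts of [x] and [y] and is the corresponding entry of [N], so
    each of [M] and [N] is obtained from the other by selecting (and repeating) rows and
    columns. Hence the two ranks agree, and each of the five graphs on four vertices has
    no adjacency eigenvalue [-1]. *)
Require Import Defs.
From mathcomp Require Import all_boot all_order all_algebra.
From mathcomp Require Import reals.
From mathcomp Require Import lra.

Set Implicit Arguments.
Unset Strict Implicit.
Unset Printing Implicit Defensive.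

Import GRing.Theory.
Local Open Scope ring_scope.

(** Selecting rows, even with repetition, keeps the row space inside that of [A]; columns are rows
    of the transpose, which has the same rank. *)
Lemma mxrank_mxsub (F : fieldType) (m n m' n' : nat)
    (f : 'I_m' -> 'I_m) (g : 'I_n' -> 'I_n) (A : 'M[F]_(m, n)) :
  (\rank (mxsub f g A) <= \rank A)%N.
Proof.
have rk_rowsub p q r (h : 'I_p -> 'I_q) (B : 'M[F]_(q, r)) :
  (\rank (rowsub h B) <= \rank B)%N by apply/mxrankS/rowsub_sub.
have -> : mxsub f g A = rowsub f (rowsub g A^T)^T by apply/matrixP=> i j; rewrite !mxE.
by apply: leq_trans (rk_rowsub _ _ _ _ _) _; rewrite mxrank_tr -[leqRHS]mxrank_tr.
Qed.

Section LoopAdjacency.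
Variables (R : realType) (G : sgraph).

Lemma loop_adjacency_mxE (i j : 'I_#|G|) :
  (1%:M + adjacency_mx R G) i j =
    ((enum_val i == enum_val j) || sedge (enum_val i) (enum_val j))%:R.
Proof.
rewrite !mxE (inj_eq enum_val_inj).
by have [->|_] := eqVneq; rewrite ?sedge_irr ?addr0 ?add0r.
Qed.

(** A square matrix with trivial left kernel has full rank. Kernel vectors are taken as functions on
    vertices so that, on a concrete graph, the sums compute to explicit linear equations. *)
Lemma mxrank_loop_adjacency_ker0 :
    (forall v : G -> R,
       (forall y, v y + \sum_x (if sedge x y then v x else 0) = 0) -> forall x, v x = 0) ->
  \rank (1%:M + adjacency_mx R G)%R = #|G|.
Proof.
move=> ker0; apply/eqP/inj_row_free=> u uM0; apply/rowP=> i.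
rewrite mxE -[i]enum_valK.
apply: (ker0 (fun x => u 0 (enum_rank x))) => y.
move/rowP/(_ (enum_rank y)): uM0; rewrite mulmxDr mulmx1 !mxE => uM0y.
rewrite -[RHS]uM0y; congr (_ + _); rewrite (reindex_onto enum_val enum_rank) /=.
  rewrite (eq_bigl xpredT) => [|j]; last by rewrite /= enum_valK eqxx.
  apply: eq_bigr => j _; rewrite mxE enum_valK enum_rankK.
  by case: ifP; rewrite ?mulr1 ?mulr0.
by move=> x _; rewrite enum_rankK.
Qed.

End LoopAdjacency.

(** [M] is [N] pulled back along [p], and [N] is [M] pulled back along the section [s], so each rank
    bounds the other. *)
Lemma mxrank_loop_adjacency_quotient (R : realType) (G H : sgraph)
    (p : G -> H) (s : H -> G) :
    cancel s p ->
    (forall x y, (x == y) || sedge x y = (p x == p y) || sedge (p x) (p y)) ->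
  \rank (1%:M + adjacency_mx R G)%R = \rank (1%:M + adjacency_mx R H)%R.
Proof.
move=> sK pE; set M := _ + adjacency_mx R G; set N := _ + adjacency_mx R H.
have MN : M = mxsub (enum_rank \o p \o enum_val) (enum_rank \o p \o enum_val) N.
  by apply/matrixP=> i j; rewrite [RHS]mxE !loop_adjacency_mxE /= !enum_rankK pE.
have NM : N = mxsub (enum_rank \o s \o enum_val) (enum_rank \o s \o enum_val) M.
  by apply/matrixP=> i j; rewrite [RHS]mxE !loop_adjacency_mxE /= !enum_rankK pE !sK.
by apply/eqP; rewrite eqn_leq {1}MN {3}NM !mxrank_mxsub.
Qed.

Lemma mxrank_loop_adjacency_structure (R : realType) (G : sgraph)
    (Om : {set {set G}}) (H : sgraph) :
    complete_partition Om -> sg_iso (structure_graph Om) H ->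
  \rank (1%:M + adjacency_mx R G)%R = \rank (1%:M + adjacency_mx R H)%R.
Proof.
move=> [partOm cliqueOm joinOm] [f [g fK gK] fE].
have /and3P[/eqP covOm trivOm /negP Om0] := partOm.
have in_cov x : x \in cover Om by rewrite covOm inE.
(* The quotient map sends a vertex to its part; a chosen representative of each part gives the
   section. *)
pose part x : structure_graph Om := exist _ (pblock Om x) (pblock_mem (in_cov x)).
have neq0 (P : structure_graph Om) : exists x, x \in val P.
  by apply/set0Pn; apply: contra_notN Om0 => /eqP <-; apply: valP.
pose pick (P : structure_graph Om) := xchoose (neq0 P).
have pickK : cancel pick part.
  move=> P; apply: val_inj; apply: def_pblock => //; first exact: valP.
  exact: xchooseP.
apply: (@mxrank_loop_adjacency_quotient R G H (f \o part) (pick \o g)).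
  by move=> y /=; rewrite pickK gK.
move=> x y; rewrite /= (inj_eq (can_inj fK)) fE /= /structure_rel /=.
have [xB yB] : x \in val (part x) /\ y \in val (part y) by rewrite /= !mem_pblock.
(* Inside one part both sides are true, the left one because the part is a clique. *)
have [eqP|neP] /= := eqVneq (part x) (part y).
  have [//|nexy /=] := eqVneq x y.
  by rewrite -eqP in yB; apply: (cliqueOm _ (valP (part x))).
have nexy : x != y by apply: contraNneq neP => ->.
have neB : val (part x) != val (part y) by rewrite (inj_eq val_inj).
rewrite (negPf nexy) /=.
have [jPQ|sPQ] := joinOm _ _ (valP (part x)) (valP (part y)) neB.
  rewrite -[pblock Om x]/(val (part x)) -[pblock Om y]/(val (part y)) jPQ.
  by move/forall_inP/(_ x xB)/forall_inP/(_ y yB): jPQ.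
have /negPf Nxy := forall_inP (forall_inP sPQ x xB) y yB.
(* The non-adjacent pair [x], [y] shows that separated parts are not joined. *)
rewrite Nxy; apply/esym/negP=> /forall_inP/(_ x xB)/forall_inP/(_ y yB).
by rewrite Nxy.
Qed.

Section FourVertexGraphs.
Variable R : realType.

Lemma mxrank_loop_adjacency_edgeless n :
  \rank (1%:M + adjacency_mx R (edgeless_graph n))%R = n.
Proof.
rewrite mxrank_loop_adjacency_ker0 ?card_ord // => v ker_v x.
by rewrite -(ker_v x) big1 ?addr0.
Qed.

(** Iterated lifts are the form in which [big_ord_recl] expands sums. *)
Local Notation o0 := ord0.
Local Notation o1 := (lift ord0 ord0).
Local Notation o2 := (lift ord0 (lift ord0 ord0)).
Local Notation o3 := (lift ord0 (lift ord0 (lift ord0 ord0))).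

(** Peels off one ordinal at a time, solving each by [lra], until ['I_0] is reached. *)
Local Ltac ord_lra x :=
  repeat (case: (unliftP ord0 x) => [{}x ->|->]; last by lra); by case: x.

(** On the path, the middle equation minus either end equation kills the opposite end, then the
    middle. *)
Lemma mxrank_loop_adjacency_K1P3 :
  \rank (1%:M +
    adjacency_mx R (union_graph (edgeless_graph 1) (path_graph 3)))%R = 4.
Proof.
rewrite mxrank_loop_adjacency_ker0 ?card_sum ?card_ord // => v ker_v.
have := (ker_v (inl o0), ker_v (inr o0), ker_v (inr o1), ker_v (inr o2)).
rewrite !big_sumType !big_ord_recl !big_ord0 /=.
by move=> [[[e0 e1] e2] e3] [x|x]; ord_lra x.
Qed.

(** The first two equations give [v o2 = 0], the last two [v o1 = 0]; the ends follow. *)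
Lemma mxrank_loop_adjacency_P4 :
  \rank (1%:M + adjacency_mx R (path_graph 4))%R = 4.
Proof.
rewrite mxrank_loop_adjacency_ker0 ?card_ord // => v ker_v.
have := (ker_v o0, ker_v o1, ker_v o2, ker_v o3).
rewrite !big_ord_recl !big_ord0 /=.
by move=> [[[e0 e1] e2] e3] x; ord_lra x.
Qed.

(** Each equation omits one vertex, so every value equals the total [S]; adding all four gives
    [3 S = 0]. *)
Lemma mxrank_loop_adjacency_C4 :
  \rank (1%:M + adjacency_mx R (cycle_graph 4))%R = 4.
Proof.
rewrite mxrank_loop_adjacency_ker0 ?card_ord // => v ker_v.
have := (ker_v o0, ker_v o1, ker_v o2, ker_v o3).
rewrite !big_ord_recl !big_ord0 /=.
by move=> [[[e0 e1] e2] e3] x; ord_lra x.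
Qed.

(** Each leaf is minus the centre [c], so the equation at the centre reads [c - 3 c = 0]. *)
Lemma mxrank_loop_adjacency_K13 :
  \rank (1%:M + adjacency_mx R (complete_bipartite_graph 1 3))%R = 4.
Proof.
rewrite mxrank_loop_adjacency_ker0 ?card_sum ?card_ord // => v ker_v.
have := (ker_v (inl o0), ker_v (inr o0), ker_v (inr o1), ker_v (inr o2)).
rewrite !big_sumType !big_ord_recl !big_ord0 /=.
by move=> [[[e0 e1] e2] e3] [x|x]; ord_lra x.
Qed.

End FourVertexGraphs.

Theorem theorem5p4 (R : realType) (G : sgraph) (Om : {set {set G}})
    (hOm : complete_skeleton Om)
    (hS : [\/ sg_iso (structure_graph Om) (edgeless_graph 4),
              sg_iso (structure_graph Om)
                     (union_graph (edgeless_graph 1) (path_graph 3)),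
              sg_iso (structure_graph Om) (path_graph 4)
            | sg_iso (structure_graph Om) (cycle_graph 4) \/
              sg_iso (structure_graph Om) (complete_bipartite_graph 1 3)]) :
  \rank (1%:M + adjacency_mx R G)%R = 4.
Proof.
have [partOm _] := hOm.
case: hS => [iso|iso|iso|[iso|iso]];
  rewrite (mxrank_loop_adjacency_structure R partOm iso).
- exact: mxrank_loop_adjacency_edgeless.
- exact: mxrank_loop_adjacency_K1P3.
- exact: mxrank_loop_adjacency_P4.
- exact: mxrank_loop_adjacency_C4.
- exact: mxrank_loop_adjacency_K13.
Qed.
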